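(* Let $G$ be an abelian semigroup (written multiplicatively), let $\Gamma$ be an additive abelian group, and let $R=\bigoplus_{g\in G}R_g$ be a graded $\Gamma$-ring of type $G$. Let $H$ be a semigroup and $\varphi: G\rightarrow H$ a surjective homomorphism of semigroups. Then the $\Gamma$-ring $S=R$, equipped with the additive subgroups $$S_h=\bigoplus_{g\in\varphi^{-1}(h)}R_g\qquad (h\in H),$$ is a graded $\Gamma$-ring of type $H$.
   Context: Let $\Gamma$ be an additive abelian group. A $\Gamma$-ring (in the sense of Barnes) is an additive abelian group $R$ together with a map $R\times\Gamma\times R\to R$, $(x,\alpha,y)\mapsto x\alpha y$, such that for all $x,y,z\in R$ and $\alpha,\beta\in\Gamma$: $(x+y)\alpha z=x\alpha z+y\alpha z$, $x(\alpha+\beta)z=x\alpha z+x\beta z$, $x\alpha(y+z)=x\alpha y+x\alpha z$, and $(x\alpha y)\beta z=x\alpha(y\beta z)$. No unity is assumed. For an abelian semigroup $G$ written multiplicatively, a $\Gamma$-ring $R$ is a graded $\Gamma$-ring of type $G$ if there are additive subgroups $R_g$ ($g\in G$) of $R$ such that $R=\bigoplus_{g\in G}R_g$ and $x\gamma y\in R_{gh}$ for all $g,h\in G$, $x\in R_g$, $y\in R_h$, $\gamma\in\Gamma$. *)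

(* Defs.v *)
From HB Require Import structures.
From mathcomp Require Import all_boot all_order all_algebra.
From mathcomp Require Import boolp classical_sets functions cardinality fsbigop.

Set Implicit Arguments.
Unset Strict Implicit.
Unset Printing Implicit Defensive.

Import GRing.Theory.
Local Open Scope classical_set_scope.
Local Open Scope ring_scope.

(* Gamma-rings in the sense of Barnes; [gmul x a y] is the product x a y. *)
HB.mixin Record Zmodule_isGammaRing (Gamma : zmodType) R of GRing.Zmodule R := {
  gmul : R -> Gamma -> R -> R;
  gmulDl : forall (x y : R) (a : Gamma) (z : R),
    gmul (x + y) a z = gmul x a z + gmul y a z;
  gmulDm : forall (x : R) (a b : Gamma) (z : R),
    gmul x (a + b) z = gmul x a z + gmul x b z;
  gmulDr : forall (x : R) (a : Gamma) (y z : R),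
    gmul x a (y + z) = gmul x a y + gmul x a z;
  gmulA : forall (x : R) (a : Gamma) (y : R) (b : Gamma) (z : R),
    gmul (gmul x a y) b z = gmul x a (gmul y b z)
}.

#[short(type="gammaRingType")]
HB.structure Definition GammaRing (Gamma : zmodType) :=
  {R of GRing.Zmodule R & Zmodule_isGammaRing Gamma R}.

Section InternalDirectSum.
Variables (I : choiceType) (V : zmodType).
Implicit Types (D : set I) (A : I -> set V) (f : I -> V) (B : set V).

(* The finiteness clause is essential: [\sum_(i \in D) f i] is 0 by convention
   when f has infinite support on D. Values of f outside D are irrelevant. *)
Definition finite_family D A f : Prop :=
  (forall i, D i -> A i (f i)) /\ finite_set (D `&` [set i | f i != 0]).

Definition sum_of D A : set V :=
  [set x | exists2 f, finite_family D A f & x = \sum_(i \in D) f i].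

Definition independent D A : Prop :=
  forall f f', finite_family D A f -> finite_family D A f' ->
    \sum_(i \in D) f i = \sum_(i \in D) f' i -> forall i, D i -> f i = f' i.

Definition is_direct_sum D A B : Prop := B = sum_of D A /\ independent D A.

End InternalDirectSum.

(* A type of grading is by definition an abelian semigroup, so commutativity of
   G is part of the notion. *)
Record is_graded (Gamma : zmodType) (R : gammaRingType Gamma)
    (G : semigroupType) (R_ : G -> set R) : Prop := IsGraded {
  graded_typeC : commutative (fun g h : G => (g * h)%g);
  graded_subgroup : forall g, zmod_closed [in R_ g];
  graded_direct : is_direct_sum [set: G] R_ [set: R];
  graded_mul : forall (g h : G) (x y : R) (a : Gamma),
    R_ g x -> R_ h y -> R_ (g * h)%g (gmul x a y)
}.

Definition coarsening (V : zmodType) (G H : choiceType) (phi : G -> H)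
    (R_ : G -> set V) : H -> set V :=
  fun h => sum_of (phi @^-1` [set h]) R_.

(* Main.v *)
Require Import Defs.
From HB Require Import structures.
From mathcomp Require Import all_boot all_order all_algebra.
From mathcomp Require Import finmap.
From mathcomp Require Import boolp classical_sets functions cardinality fsbigop.

Set Implicit Arguments.
Unset Strict Implicit.
Unset Printing Implicit Defensive.

Local Open Scope classical_set_scope.
Local Open Scope ring_scope.

Import GRing.Theory.

(** A family of homogeneous components indexed by [G] can be grouped along the fibres of [phi];
    conversely, a family of elements of the coarsened pieces can be split into components inside
    each fibre. Both operations can be done with finite supports, and by [fsum_fibers] they keep the
    total sum. Hence existence and uniqueness of decompositions pass from [R_] to its coarsening
    ([is_direct_sum_coarsening]). Each coarsened piece is itself a direct sum because independence
    restricts to a fibre ([independent_sub]). Products are reduced to homogeneous elements by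
    additivity in each argument ([gmul_sum_of]), where [phi] being multiplicative gives the degree;
    surjectivity of [phi] carries commutativity over to [H]. *)

Lemma fsumrB (I : choiceType) (V : zmodType) (D : set I) (f f' : I -> V) :
  finite_set (D `&` [set i | f i != 0]) ->
  finite_set (D `&` [set i | f' i != 0]) ->
  \sum_(i \in D) (f i - f' i) = \sum_(i \in D) f i - \sum_(i \in D) f' i.
Proof.
move=> ff ff'; set X := D `&` ([set i | f i != 0] `|` [set i | f' i != 0]).
have finX : finite_set X by rewrite /X setIUr finite_setU.
have suppX i : (D `\` X) i -> f i = 0 /\ f' i = 0.
  move=> [Di] /not_andP[//|] /not_orP[/negP fi /negP f'i].
  by split; apply/eqP; rewrite -[_ == _]negbK.
(* [X] contains both supports, so all three sums become sums over one common list, where [sumrB]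
   applies. *)
have widX (g : I -> V) : (forall i, f i = 0 /\ f' i = 0 -> g i = 0) ->
    \sum_(i \in D) g i = \sum_(i <- fset_set X) g i.
  move=> g0; rewrite -(fsbig_widen X) ?fsbig_finite//; first by move=> i [].
  by move=> i /suppX/g0.
by rewrite !widX ?sumrB// => i [fi f'i]; rewrite ?fi ?f'i ?subr0.
Qed.

(* The fibrewise sums are taken over a list [r] supporting [f], and the outer
   one over the image of [r], where finite sums may be exchanged. *)
Lemma fsum_fibers (G H : choiceType) (V : zmodType) (phi : G -> H) (f : G -> V) :
  finite_set [set g | f g != 0] ->
  \sum_(h \in [set: H]) \sum_(g \in phi @^-1` [set h]) f g =
  \sum_(g \in [set: G]) f g.
Proof.
move=> fin; set r : seq G := fset_set [set g | f g != 0].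
have f0 g : g \notin r -> f g = 0.
  by rewrite in_fset_set// notin_setE => /negP; rewrite negbK => /eqP.
have ur : uniq r by exact: fset_uniq.
have fiberE h :
    \sum_(g \in phi @^-1` [set h]) f g = \sum_(g <- r | phi g == h) f g.
  rewrite [RHS]bigfs//; last by move=> g _ gr; exact: f0.
  by apply: eq_fsbigl; apply/seteqP; split=> g /= /eqP.
under eq_fsbigr do rewrite fiberE.
have -> : \sum_(g \in [set: G]) f g = \sum_(g <- r) f g.
  rewrite [RHS]bigfs//; last by move=> g _ gr; exact: f0.
  by apply: eq_fsbigl; apply/seteqP; split.
set s := undup (map phi r).
(* No index of [r] lies above an [h] outside [s], so the fibre sum there is empty and the outer sum
   can be cut down to [s]. *)
rewrite -(fsbig_widen [set` s])//; last first.
  move=> h [_ /= hs]; rewrite big_seq_cond big1// => g /andP[gr /eqP gh].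
  by case: hs; rewrite -gh mem_undup map_f.
rewrite -fsbig_seq ?undup_uniq// (exchange_big_dep xpredT)//=.
rewrite big_seq [RHS]big_seq; apply: eq_bigr => g gr.
(* After the exchange, [f g] is counted only at [phi g], which occurs exactly once in [s] thanks to
   [undup]. *)
rewrite big_mkcond (bigD1_seq (phi g)) ?undup_uniq ?mem_undup ?map_f//= eqxx.
by rewrite big1 ?addr0// => h; rewrite eq_sym => /negPf->.
Qed.

Lemma zmod_closed_addr (V : zmodType) (B : set V) :
  zmod_closed [in B] -> B 0 /\ (forall x y, B x -> B y -> B (x + y)).
Proof.
move=> [B0 BB]; split=> [|x y Bx By]; first exact: set_mem.
suff : x - (0 - y) \in B by rewrite sub0r opprK inE.
by apply: (BB); rewrite ?inE//; apply/set_mem/BB => //; rewrite inE.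
Qed.

Section SumOf.
Variables (I : choiceType) (V : zmodType).
Implicit Types (D : set I) (A : I -> set V) (B : set V).

Lemma sum_of_sub D A B : B 0 -> (forall x y, B x -> B y -> B (x + y)) ->
  (forall i, D i -> A i `<=` B) -> sum_of D A `<=` B.
Proof.
move=> B0 BD AB x [f [Af ff] ->]; rewrite big_seq.
apply: (big_ind B) => // i.
case: finite_supportP => // X XD _ _ iX.
by apply: (AB i); [exact: XD|apply/Af/XD].
Qed.

Lemma sub_sum_of D A i : (forall i, zmod_closed [in A i]) -> D i ->
  A i `<=` sum_of D A.
Proof.
move=> Azm Di x Ax.
have A0 j : A j 0 by have [] := zmod_closed_addr (Azm j).
exists (fun j => if j == i then x else 0).
  split=> [j Dj|]; first by case: eqP => [->|].
  apply: (sub_finite_set _ (finite_set1 i)) => j [_] /=.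
  by case: (eqVneq j i) => // _; rewrite eqxx.
rewrite -(fsbig_widen [set i]) ?fsbig_set1 ?eqxx//=; [by move=> j ->|].
by move=> j [_ /= /eqP/negPf ->].
Qed.

Lemma zmod_closed_sum_of D A : (forall i, zmod_closed [in A i]) ->
  zmod_closed [in sum_of D A].
Proof.
move=> Azm; split.
  rewrite inE; exists (fun=> 0); last by rewrite fsbig1.
  split=> [i _|]; first by have [] := zmod_closed_addr (Azm i).
  by rewrite (_ : _ `&` _ = set0)//; apply/seteqP; split=> // i [_]/=; rewrite eqxx.
move=> x y; rewrite !inE => -[f [Af ff] ->] [f' [Af' ff'] ->].
exists (fun i => f i - f' i); last by rewrite fsumrB.
split=> [i Di|].
  by have [_] := Azm i => /(_ (f i) (f' i)); rewrite !inE; apply; [exact: Af|exact: Af'].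
apply: (@sub_finite_set _ _
  ((D `&` [set i | f i != 0]) `|` (D `&` [set i | f' i != 0]))).
  move=> i [Di /=]; have [->|fi] := eqVneq (f i) 0; last by left.
  by rewrite sub0r oppr_eq0; right.
by rewrite finite_setU.
Qed.

(** Extension by 0 turns a family over [D'] into a family over [D] with the same sum; it stays
    admissible because every [A i] contains 0. *)
Lemma independent_sub D D' A : (forall i, A i 0) -> D' `<=` D ->
  independent D A -> independent D' A.
Proof.
move=> A0 DD' ind f f' [Af ff] [Af' ff'] sum_eq i D'i.
have ext g : finite_family D' A g -> finite_family D A (patch (fun=> 0) D' g).
  move=> [Ag fg]; split=> [j Dj|].
    by rewrite /patch; case: ifPn => // /set_mem/Ag.
  apply: sub_finite_set fg => j [_ /=]; rewrite /patch.
  by case: ifPn => [/set_mem|]; rewrite ?eqxx.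
have sumE (g : I -> V) : \sum_(j \in D) patch (fun=> 0) D' g j = \sum_(j \in D') g j.
  rewrite -(fsbig_widen D')//.
    by apply: eq_fsbigr => j jD'; rewrite /patch jD'.
  by move=> j [_ /= D'j]; rewrite /patch memNset.
have := ind _ _ (ext f (conj Af ff)) (ext f' (conj Af' ff')).
by rewrite !sumE => /(_ sum_eq i (DD' _ D'i)); rewrite /patch mem_set.
Qed.

End SumOf.

Section Coarsening.
Variables (V : zmodType) (G H : choiceType) (phi : G -> H) (R_ : G -> set V).
Hypothesis R_zmod : forall g, zmod_closed [in R_ g].

Lemma finite_family_fibers f : finite_family setT R_ f ->
  finite_family setT (coarsening phi R_)
    (fun h => \sum_(g \in phi @^-1` [set h]) f g).
Proof.
move=> [Rf]; rewrite setTI => ff; split=> [h _|].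
  by exists f => //; split=> [g _|]; [exact: Rf|exact: finite_setIr].
(* A nonzero fibre sum has a nonzero term, so the new support lies in the image under [phi] of the
   support of [f]. *)
rewrite setTI; apply: sub_finite_set (finite_image phi ff) => h /=.
by move=> /(@fsbigN1 _ _ _ H G _ (fun=> f) h)[g /= <- fg]; exists g.
Qed.

(* The components of [F h] are discarded where [F h = 0], since the chosen
   decompositions of 0 could have nonzero terms in infinitely many fibres. *)
Lemma refine_family F : finite_family setT (coarsening phi R_) F ->
  exists2 f, finite_family setT R_ f &
    F = (fun h => \sum_(g \in phi @^-1` [set h]) f g).
Proof.
move=> [SF]; rewrite setTI => fF.
have R0 g : R_ g 0 by have [] := zmod_closed_addr (R_zmod g).
pose dec h : {f | finite_family (phi @^-1` [set h]) R_ f &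
    F h = \sum_(g \in phi @^-1` [set h]) f g} := cid2 (SF h Logic.I).
pose d h := s2val (dec h).
have dP h : finite_family (phi @^-1` [set h]) R_ (d h) := s2valP (dec h).
have dE h : F h = \sum_(g \in phi @^-1` [set h]) d h g := s2valP' (dec h).
exists (fun g => if F (phi g) == 0 then 0 else d (phi g) g).
  split=> [g _|].
    by case: ifP => // _; have [+ _] := dP (phi g); apply.
  rewrite setTI; apply: (@sub_finite_set _ _ (\bigcup_(h in [set h | F h != 0])
      (phi @^-1` [set h] `&` [set g | d h g != 0]))).
    move=> g /=; case: ifPn => [_|Fg dg]; first by rewrite eqxx.
    by exists (phi g).
  by apply: bigcup_finite => // h _; have [] := dP h.
apply/funext => h; have [Fh|Fh] := eqVneq (F h) 0.
  by rewrite Fh fsbig1// => g /= ->; rewrite Fh eqxx.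
rewrite dE; apply: eq_fsbigr => g /set_mem /= ->.
by rewrite (negPf Fh).
Qed.

Lemma is_direct_sum_coarsening B : is_direct_sum setT R_ B ->
  is_direct_sum setT (coarsening phi R_) B.
Proof.
move=> [-> ind].
have sumE f : finite_family setT R_ f -> \sum_(g \in setT) f g =
    \sum_(h \in setT) \sum_(g \in phi @^-1` [set h]) f g.
  by move=> [_]; rewrite setTI => ff; rewrite fsum_fibers.
split.
  apply/seteqP; split=> x [].
    move=> f Rf ->; rewrite sumE//.
    by exists (fun h => \sum_(g \in phi @^-1` [set h]) f g); first
      exact: finite_family_fibers.
  by move=> F /refine_family[f Rf ->] ->; exists f; rewrite ?sumE.
(* The refinements of [F] and [F'] have equal total sums, so they agree termwise by independence of
   [R_], and hence so do their fibre sums. *)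
move=> F F' /refine_family[f Rf ->] /refine_family[f' Rf' ->].
rewrite -!sumE// => /(ind _ _ Rf Rf') ff' h _.
by apply: eq_fsbigr => g _; rewrite ff'.
Qed.

End Coarsening.

(** For fixed [y], the set of [x] with [gmul x a y] in [C] contains 0 and is closed under addition,
    so by [sum_of_sub] it is enough to test [x] in some [A i]; the same argument in the other
    variable then reduces to [y] in some [B j]. *)
Lemma gmul_sum_of (Gamma : zmodType) (R : gammaRingType Gamma)
    (I J : choiceType) (D : set I) (E : set J) (A : I -> set R)
    (B : J -> set R) (C : set R) (a : Gamma) :
  zmod_closed [in C] ->
  (forall i j x y, D i -> E j -> A i x -> B j y -> C (gmul x a y)) ->
  forall x y, sum_of D A x -> sum_of E B y -> C (gmul x a y).
Proof.
move=> /zmod_closed_addr[C0 CD] ABC x y Ax By.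
have gmul0 z : gmul 0 a z = 0.
  by apply: (addIr (gmul 0 a z)); rewrite -gmulDl !add0r.
have gmulr0 z : gmul z a 0 = 0.
  by apply: (addIr (gmul z a 0)); rewrite -gmulDr !add0r.
apply: (@sum_of_sub I R D A [set x | C (gmul x a y)]) Ax => /=.
- by rewrite gmul0.
- by move=> u v Cu Cv; rewrite gmulDl; exact: CD.
move=> i Di u Au /=.
apply: (@sum_of_sub J R E B [set y | C (gmul u a y)]) By => /=.
- by rewrite gmulr0.
- by move=> v w Cv Cw; rewrite gmulDr; exact: CD.
by move=> j Ej v Bv /=; exact: ABC Di Ej Au Bv.
Qed.

Theorem theorem4p1 (G : semigroupType) (Gamma : zmodType)
    (R : gammaRingType Gamma) (R_ : G -> set R) (H : semigroupType)
    (phi : {multiplicative G -> H}) :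
  commutative (fun g g' : G => (g * g')%g) ->
  is_graded R_ ->
  (forall h : H, exists g : G, phi g = h) ->
  (forall h : H,
     is_direct_sum (phi @^-1` [set h]) R_ (coarsening phi R_ h)) /\
  is_graded (coarsening phi R_).
Proof.
move=> GC [_ R_zmod R_direct R_mul] phi_surj; split=> [h|].
  split=> //; apply: independent_sub R_direct.2 => // g.
  by have [] := zmod_closed_addr (R_zmod g).
split.
- move=> h k; have [g <-] := phi_surj h; have [g' <-] := phi_surj k.
  by rewrite -!gmulfM GC.
- by move=> h; exact: zmod_closed_sum_of.
- exact: is_direct_sum_coarsening.
move=> h k x y a; apply: gmul_sum_of; first exact: zmod_closed_sum_of.
move=> g g' u v /= gh g'k Ru Rv; apply: (@sub_sum_of _ _ _ _ (g * g')%g) => //.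
  by rewrite /= gmulfM gh g'k.
exact: R_mul.
Qed.
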